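(* Let $\alpha_1=\alpha>1$ be a Salem number of degree $d=2s\geq 4$ whose conjugates $\alpha_1,\dots,\alpha_d$ over $\mathbb{Q}$ are labelled so that $\alpha_2=1/\alpha_1$ and $\alpha_{2j}=1/\alpha_{2j-1}=\overline{\alpha_{2j-1}}$ for $j=2,\dots,s$. If for some rational numbers $k_1,\dots,k_d$ and some totally real algebraic number $\gamma$ we have $$k_1\alpha_1+k_2\alpha_2+\dots+k_d\alpha_d=\gamma,$$ then $k_{2j-1}=k_{2j}$ for each $j=1,\dots,s$.
   Context: A Salem number is an algebraic integer $\alpha>1$ all of whose other conjugates over $\mathbb{Q}$ lie in the closed unit disc $|z|\le 1$, with at least one conjugate on the circle $|z|=1$. An algebraic number is totally real if all its conjugates over $\mathbb{Q}$ are real. *)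

(* Defs.v *)
From mathcomp Require Import all_boot all_order all_algebra all_field.
Set Implicit Arguments.
Unset Strict Implicit.
Unset Printing Implicit Defensive.
Import Order.TTheory GRing.Theory Num.Theory.
Local Open Scope ring_scope.

(* [minCpoly x] is the minimal polynomial of [x] over the rationals. *)
Definition Qconjugate (x y : algC) : bool := root (minCpoly x) y.

Definition Qdegree (x : algC) : nat := (size (minCpoly x)).-1.

(* The order of [algC] is partial: [1 < a] forces [a] to be real. *)
Definition Salem (a : algC) : Prop :=
  [/\ a \in Aint,
      1 < a,
      forall z : algC, Qconjugate a z -> z != a -> `|z| <= 1
    & exists2 z : algC, Qconjugate a z & `|z| = 1].

Definition totally_real (g : algC) : Prop :=
  forall z : algC, Qconjugate g z -> z \is Creal.

(* [al 1, ..., al d] lists every conjugate of [a] exactly once; the values of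
   [al] at other indices are irrelevant. *)
Definition conjugates_labelling (a : algC) (d : nat) (al : nat -> algC) : Prop :=
  {in [pred i | 1 <= i <= d]%N &, injective al} /\
  (forall z : algC, Qconjugate a z <-> exists2 i, (1 <= i <= d)%N & al i = z).

(* Main.v *)
Require Import Defs.
From HB Require Import structures.
From mathcomp Require Import all_boot all_order all_algebra all_field.
From mathcomp Require Import ring zify.
Import Order.TTheory GRing.Theory Num.Theory.
Local Open Scope ring_scope.

(** Complex conjugation fixes [a] and [1 / a] and inverts every other conjugate
    of [a].  Let [m_j = k_(2j-1) - k_(2j)] and
    [T_j = m_j (al_(2j-1) - al_(2j))].  For every [l] there is an automorphism
    [mu] sending [al_(2l-1)] to [a]; since [mu g] is real, [mu g - (mu g)^*],
    which equals the image by [mu] of the sum of the [T_j] over [j <> l],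
    vanishes.  So every [T_l] equals the sum of all the [T_j]; as there are at
    least two of them, they all vanish. *)

(** The isomorphism from Q(b) onto Q(c) that sends [b] to [c] extends to the splitting field [Qs] of
    the minimal polynomial of [b], which is normal, and from there to [algC]. *)
Lemma Qconjugate_aut_exists (b c : algC) :
  Qconjugate b c -> exists nu : {rmorphism algC -> algC}, nu b = c.
Proof.
rewrite /Qconjugate => bc.
have [q [Dq mon_q] min_q] := minCpolyP b.
have [r] := closed_field_poly_normal (minCpoly b).
rewrite (monicP (minCpoly_monic b)) scale1r => Dr.
have [Qs [QsC [rs Drs genQs]]] := num_field_exists r.
have QsC_poly p : map_poly QsC (map_poly (in_alg Qs) p) = map_poly ratr p.
  rewrite -map_poly_comp; apply: eq_map_poly => x.
  by rewrite /= alg_num_field fmorph_rat.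
have [z _ Dz] : exists2 z, z \in rs & b = QsC z.
  by apply/mapP; rewrite Drs -root_prod_XsubC -Dr root_minCpoly.
have [w _ Dw] : exists2 w, w \in rs & c = QsC w.
  by apply/mapP; rewrite Drs -root_prod_XsubC -Dr.
have Dp : map_poly (in_alg Qs) q = \prod_(x <- rs) ('X - x%:P).
  apply: (map_poly_inj QsC); rewrite QsC_poly -Dq Dr -Drs big_map rmorph_prod.
  by apply: eq_bigr => x _; rewrite rmorphB /= map_polyX map_polyC.
have hom1 : kHom 1 1 (\1%VF : 'End(Qs)) by rewrite kHom1.
(* The minimal polynomial of [z] over Q has rational coefficients and, mapped to [algC], vanishes at
   [b]; so [q] divides it and it also vanishes at [c]. *)
have rw : root (map_poly \1%VF (minPoly 1 z)) w.
  rewrite map_poly_id => [|x _]; last by rewrite id_lfunE.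
  have /polyOver1P[p Ep] := minPolyOver 1 z.
  rewrite -(fmorph_root QsC) /= -Dw Ep QsC_poly.
  have : root (map_poly ratr p) b.
    by rewrite Dz -QsC_poly -Ep fmorph_root root_minPoly.
  rewrite min_q => /dvdpP[u ->].
  by rewrite rmorphM rootM /= -Dq bc orbT.
have homz := kHomExtendP (subvv 1%AS) hom1 rw.
have splitQs : splittingFieldFor 1 (map_poly (in_alg Qs) q) fullv.
  by exists rs; rewrite ?Dp ?eqpxx.
have over_q : map_poly (in_alg Qs) q \is a polyOver 1%VS.
  by apply/polyOver1P; exists q.
have [f homf Df] := kHom_extends (sub1v _) homz over_q
  (splittingFieldForS (sub1v _) (subvf _) splitQs).
have fz : f z = w.
  by rewrite -Df ?memv_adjoin // (kHomExtend_val hom1 rw).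
have /kHom_monoid_morphism fM := homf.
pose fMM := GRing.isMonoidMorphism.Build _ _ f fM.
pose fRM : {rmorphism Qs -> Qs} := HB.pack (fun_of_lfun f) fMM.
have [nu Dnu] := extend_algC_subfield_aut QsC fRM.
by exists nu; rewrite Dz -Dnu /= fz Dw.
Qed.

Lemma Qconjugate_aut (nu : {rmorphism algC -> algC}) (b z : algC) :
  Qconjugate b z -> Qconjugate b (nu z).
Proof.
move=> /Qconjugate_aut_exists[mu <-].
by rewrite /Qconjugate -(minCpoly_aut mu) -(minCpoly_aut nu) root_minCpoly.
Qed.

Lemma Qconjugate_sym (b c : algC) : Qconjugate b c -> Qconjugate c b.
Proof.
by case/Qconjugate_aut_exists=> nu <-; rewrite /Qconjugate minCpoly_aut
  root_minCpoly.
Qed.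

(** If [S] is the total, each [T i] equals [S]. Summing over the [s] indices gives [S = s S], that
    is [(s - 1) S = 0] with [s - 1 > 0], in characteristic zero. *)
Lemma co1_sums_eq0 (R : numDomainType) (s : nat) (T : 'I_s -> R) :
    (1 < s)%N -> (forall l, \sum_(j | j != l) T j = 0) ->
  forall j, T j = 0.
Proof.
move=> s_gt1 T0 j.
have DT i : T i = \sum_l T l by rewrite (bigD1 i) //= T0 addr0.
have /eqP : \sum_l T l = (\sum_l T l) *+ s.
  by rewrite {1}(eq_bigr _ (fun i _ => DT i)) sumr_const card_ord.
rewrite DT; case: (s) s_gt1 (\sum_l T l) => [|[|n]] // _ S.
by rewrite mulrS addrC -subr_eq subrr eq_sym mulrn_eq0 => /eqP.
Qed.

Lemma big_nat_pairs (R : nmodType) (F : nat -> R) (s : nat) :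
  \sum_(1 <= i < (2 * s).+1) F i = \sum_(j < s) (F (2 * j).+1 + F (2 * j).+2).
Proof.
elim: s => [|s IHs]; first by rewrite big_ord0 big_geq.
by rewrite big_ord_recr -IHs mulnS !addSn add0n 2?big_nat_recr //= addrA.
Qed.

Theorem theorem1p1 (a : algC) (d s : nat) (al : nat -> algC)
    (k : nat -> rat) (g : algC)
    (Sa : Salem a) (deg_a : Qdegree a = d)
    (d_2s : d = (2 * s)%N) (d_ge4 : (4 <= d)%N)
    (al_conj : conjugates_labelling a d al)
    (al_1 : al 1%N = a) (al_2 : al 2%N = (al 1%N)^-1)
    (al_pair : forall j : nat, (2 <= j <= s)%N ->
       al (2 * j)%N = (al (2 * j - 1)%N)^-1 /\
       (al (2 * j - 1)%N)^-1 = (al (2 * j - 1)%N)^*)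
    (g_real : totally_real g)
    (rel_g : \sum_(1 <= i < d.+1) ratr (k i) * al i = g) :
  forall j : nat, (1 <= j <= s)%N -> k (2 * j - 1)%N = k (2 * j)%N.
Proof.
have [_ a_gt1 _ _] := Sa; have [al_inj al_onto] := al_conj.
have a_real : a^* = a.
  by apply/CrealP/gtr0_real/(lt_trans ltr01).
have s_gt1 : (1 < s)%N by lia.
(* Pairs are now numbered from 0: pair 0 is [a] and its inverse, and pair [j] carries the labels
   [2j+1] and [2j+2]. *)
pose x (j : 'I_s) := al (2 * j).+1; pose y (j : 'I_s) := al (2 * j).+2.
have Dy j : y j = (x j)^-1.
  rewrite /x /y; case: j => [[|j] lt_j] /=; first by rewrite muln0.
  have [] := al_pair j.+2 _; first by lia.
  have [-> ->] : (2 * j.+2 - 1 = (2 * j.+1).+1 /\ 2 * j.+2 = (2 * j.+1).+2)%N.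
    by lia.
  by [].
have x_conj j : Qconjugate a (x j).
  by apply/al_onto; exists (2 * j).+1 => //; case: j => j /=; lia.
have conj_inv z : Qconjugate a z -> z != a -> z != a^-1 -> z^* = z^-1.
  move=> /al_onto[i id <-] nz1 nz2.
  have [j /andP[j_gt1 j_le] Di] :
      exists2 j, (2 <= j <= s)%N & i = (2 * j - 1)%N \/ i = (2 * j)%N.
    have i1 : i != 1%N by apply: contraNneq nz1 => ->; rewrite al_1.
    have i2 : i != 2%N by apply: contraNneq nz2 => ->; rewrite al_2 al_1.
    (* Numbered from 1, the pair containing the label [i] is [i / 2] rounded up; it is at least 2
       because [i >= 3]. *)
    by exists (i.+1 %/ 2)%N; lia.
  have [|E1 E2] := al_pair j; first by rewrite j_gt1.
  by case: Di => ->; [rewrite E2 | rewrite E1 E2 conjCK -E2 invrK].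
pose q1 (j : 'I_s) : algC := ratr (k (2 * j).+1).
pose q2 (j : 'I_s) : algC := ratr (k (2 * j).+2).
have aut_lin (nu : {rmorphism algC -> algC}) j u v :
    nu (q1 j * u + q2 j * v) = q1 j * nu u + q2 j * nu v.
  by rewrite rmorphD (rmorphM nu (q1 j)) (rmorphM nu (q2 j)) !fmorph_rat.
(* The term [m_j (x_j - y_j)] is split in two so that [aut_lin] applies to it. *)
have T0 : forall j, q1 j * (x j - y j) + q2 j * (y j - x j) = 0.
  apply: co1_sums_eq0 s_gt1 _ => l.
  have [mu Dmu] := Qconjugate_aut_exists _ _ (Qconjugate_sym _ _ (x_conj l)).
  apply/eqP; rewrite -(fmorph_eq0 mu) rmorph_sum /=; apply/eqP.
  have mug_real : mu g \is Creal.
    by apply/g_real; rewrite /Qconjugate -(minCpoly_aut mu) root_minCpoly.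
  have Dg : g = \sum_j (q1 j * x j + q2 j * y j).
    by rewrite -rel_g d_2s big_nat_pairs.
  transitivity (mu g - (mu g)^*); last by rewrite (CrealP mug_real) subrr.
  (* The automorphism turns the term of index [l] into [q1 l * a + q2 l / a], which is real and
     cancels in the difference. *)
  rewrite Dg !rmorph_sum -sumrB [RHS](bigD1 l) //= aut_lin Dy fmorphV Dmu.
  rewrite aut_lin fmorphV /= a_real subrr add0r.
  apply: eq_bigr => j jl.
  (* Since [mu] is injective and the labels are distinct, [mu (x j)] differs from [a = mu (x l)] and
     from [1 / a = mu (y l)]. *)
  have muxj : (mu (x j))^* = (mu (x j))^-1.
    apply: conj_inv; first exact: Qconjugate_aut.
      rewrite -Dmu fmorph_eq; apply: contra jl => /eqP/al_inj E.
      apply/eqP/val_inj; move: E; rewrite !inE.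
      by case: (j) (l) => j' ? [l' ?] /=; lia.
    rewrite -Dmu -fmorphV -Dy fmorph_eq; apply/eqP => /al_inj E.
    by move: E; rewrite !inE; case: (j) (l) => j' ? [l' ?] /=; lia.
  rewrite !aut_lin !rmorphB Dy !fmorphV /= muxj invrK; ring.
move=> j /andP[j_gt0 j_le].
have lt_j : (j.-1 < s)%N by lia.
have /eqP := T0 (Ordinal lt_j).
(* The product [(q1 - q2) (x - y)] vanishes, and distinct labels exclude [x = y]. *)
rewrite -(opprB (x _)) mulrN -mulrBl mulf_eq0 !subr_eq0.
case/orP => [/eqP/fmorph_inj/= |/eqP/al_inj E]; last first.
  by move: E; rewrite !inE /=; lia.
have [-> ->] : ((2 * j.-1).+2 = 2 * j /\ (2 * j.-1).+1 = 2 * j - 1)%N by lia.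
by [].
Qed.
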